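(* Let $n$ and $k$ be positive integers and let $x$ be an integer. If a family $F$ of subsets of $[n]=\{1,\dots,n\}$ satisfies $|F| = x + \Sigma(n,k-1)$, then there are at least $$x\cdot\prod_{i=1}^{k-1}\left(\left\lfloor\frac{n+k}{2}\right\rfloor-i+1\right)$$ copies of $\mathcal{P}_k$ in $F$, that is, at least this many $k$-chains $A_1\subsetneq A_2\subsetneq\dots\subsetneq A_k$ with $A_1,\dots,A_k\in F$.
   Context: For a set $S$, $\binom{S}{j}$ denotes the collection of all $j$-element subsets of $S$ (empty if $j<0$ or $j>|S|$). For an integer $m\ge 0$, $\mathcal{B}(n,m)$ denotes a family of all subsets of $[n]$ of the $m$ middle sizes, i.e. either $$\mathcal{B}(n,m)=\binom{[n]}{\lfloor (n-m+1)/2\rfloor}\cup\cdots\cup\binom{[n]}{\lfloor (n+m-1)/2\rfloor}$$ or $$\mathcal{B}(n,m)=\binom{[n]}{\lceil (n-m+1)/2\rceil}\cup\cdots\cup\binom{[n]}{\lceil (n+m-1)/2\rceil}.$$ (Depending on the parity of $n$ and $m$, these are one or two different families; they have the same size. For $m=0$ the family is empty.) $\Sigma(n,m)=|\mathcal{B}(n,m)|$ denotes the common size, i.e. the sum of the $m$ middle binomial coefficients $\binom{n}{j}$; in particular $\Sigma(n,0)=0$. $\mathcal{P}_k$ denotes the $k$-element totally ordered set (chain). Families of subsets are ordered by inclusion, and a copy of $\mathcal{P}_k$ in $F$ is a set of $k$ members of $F$ that is totally ordered by inclusion. An empty product equals $1$. *)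

(* Defs.v *)
From HB Require Import structures.
From mathcomp Require Import all_boot all_order all_algebra zify.

Set Implicit Arguments.
Unset Strict Implicit.
Unset Printing Implicit Defensive.

Import Order.TTheory GRing.Theory Num.Theory.

Local Open Scope ring_scope.

(* [n] is represented by 'I_n. All bounds on the sizes are computed in int,
   as n - m + 1 is negative when m > n + 1; (a %/ 2)%Z rounds towards -oo. *)

Definition ceil_half (a : int) : int := - ((- a) %/ 2)%Z.

(* The union of the layers binom([n], j) for lo <= j <= hi. *)
Definition layers (n : nat) (lo hi : int) : {set {set 'I_n}} :=
  [set A : {set 'I_n} | lo <= #|A|%:Z <= hi].

Definition middle_floor (n m : nat) : {set {set 'I_n}} :=
  layers n ((n%:Z - m%:Z + 1) %/ 2)%Z ((n%:Z + m%:Z - 1) %/ 2)%Z.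

Definition middle_ceil (n m : nat) : {set {set 'I_n}} :=
  layers n (ceil_half (n%:Z - m%:Z + 1)) (ceil_half (n%:Z + m%:Z - 1)).

Definition Sigma (n m : nat) : nat := #|middle_floor n m|.

Lemma card_middle_ceil (n m : nat) : #|middle_ceil n m| = Sigma n m.
Proof.
have -> : middle_ceil n m = [set ~: A | A in middle_floor n m].
  apply/setP => A; rewrite -[A in RHS]setCK (mem_imset _ _ (can_inj (@setCK _))).
  rewrite !inE /ceil_half; have := cardsC A; rewrite card_ord; lia.
by rewrite card_imset //; exact: can_inj (@setCK _).
Qed.

Lemma Sigma0 (n : nat) : Sigma n 0 = 0%N.
Proof. by apply/eqP; rewrite cards_eq0; apply/eqP/setP => A; rewrite !inE; lia. Qed.

Definition is_chain (n : nat) (C : {set {set 'I_n}}) : bool :=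
  [forall A in C, forall B in C, (A \subset B) || (B \subset A)].

Definition chain_copies (n k : nat) (F : {set {set 'I_n}}) :
    {set {set {set 'I_n}}} :=
  [set C : {set {set 'I_n}} | [&& C \subset F, #|C| == k & is_chain C]].

(* Main.v *)
(** Fix a symmetric chain decomposition of the Boolean lattice.  Counting
    along each of its chains shows that at least [x] of the [k]-chains of [F]
    lie in a single chain of the decomposition, and the same holds after
    applying any permutation of the ground set.  A [k]-chain with sizes
    [a_1 < ... < a_k] is mapped into a single chain by at most
    [n! / prod_j binom(a_(j+1), a_j)] permutations, because its top member
    determines the images of the others; complementing if necessary, one has
    [a_1 + a_k >= n], and then this product is at least the falling factorial
    of length [k - 1] of [floor((n + k) / 2)] as soon as [a_1 > 0].  Averaging
    over all permutations settles the case where [F] does not contain both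
    the empty and the full set.  Otherwise the empty set alone lies in enough
    [k]-chains, by the settled case for [k - 1], and it can be removed. *)

Require Import Defs.
From mathcomp Require Import all_boot all_order all_algebra all_fingroup.
From mathcomp Require Import zify ring.

Set Implicit Arguments.
Unset Strict Implicit.
Unset Printing Implicit Defensive.

(** * A symmetric chain decomposition of the Boolean lattice *)

(* Greene-Kleitman bracketing, reading [true] as a letter that closes an
   available [false] of the tail: [bracket w] marks the matched [true]s, so
   two words get the same image iff they lie in the same symmetric chain. *)
Fixpoint bracket (w : bitseq) : bitseq :=
  if w is b :: v then
    (b && (count id v + count id (bracket v) < size v)) :: bracket v
  else [::].

Lemma size_bracket w : size (bracket w) = size w.
Proof. by elim: w => //= b v ->. Qed.

Lemma count_bracket w :
  count id (bracket w) <= count id w /\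
  count id w + count id (bracket w) <= size w.
Proof.
elim: w => //= b v; have := count_size id (bracket v).
rewrite size_bracket; case: b => /=; case: ltnP; lia.
Qed.

(** An unmatched [true] at the head means that the tail is at the top of its chain. So an unmatched
    head is [true] only in the top word of a class, while a matched head is [true] throughout. *)
Lemma bracket_chain w1 w2 :
  bracket w1 = bracket w2 -> count id w1 <= count id w2 ->
  forall i, nth false w1 i -> nth false w2 i.
Proof.
elim: w1 w2 => [|b1 v1 IH] [|b2 v2] //=.
case=> eqb eqv le12.
have eqs : size v1 = size v2 by rewrite -size_bracket eqv size_bracket.
have [_ top1] := count_bracket v1; have [_ top2] := count_bracket v2.
have le_v : count id v1 <= count id v2.
  by move: eqb le12 top1 top2; rewrite eqv eqs; case: b1 b2 => [] []; lia.
have le_b : b1 -> b2.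
  by move: eqb le12 top1 top2; rewrite eqv eqs; case: b1 b2 => [] []; lia.
by case=> [|i] //=; exact: IH.
Qed.

(** A matched head puts [true] before every word of the tail's chain but the top one; an unmatched
    head puts [false] before all of them and adds [true] before the top one. *)
Lemma bracket_full w j :
  count id (bracket w) <= j -> j + count id (bracket w) <= size w ->
  exists2 w', bracket w' = bracket w & count id w' = j.
Proof.
elim: w j => [|b v IH] j /=; first by exists [::] => //=; lia.
case: (boolP (b && _)) => [lab|lab] /= lej jle.
  have [] := IH j.-1; [lia | lia |] => v' eqv cv; exists (true :: v') => /=; last lia.
  have eqs : size v' = size v by rewrite -size_bracket eqv size_bracket.
  by rewrite eqv; congr cons; rewrite eqs; lia.
have [jtop|jtop] := leqP (j + count id (bracket v)) (size v).
  have [] := IH j; [lia | lia |] => v' eqv cv; exists (false :: v') => //=.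
  by rewrite eqv.
have [bot top] := count_bracket v; have [] := IH j.-1; [lia | lia |] => v' eqv cv.
exists (true :: v') => /=; last lia.
have eqs : size v' = size v by rewrite -size_bracket eqv size_bracket.
by rewrite eqv; congr cons; rewrite eqs; lia.
Qed.

Definition word n (A : {set 'I_n}) : bitseq := [seq i \in A | i <- enum 'I_n].

Definition set_of_word n (w : bitseq) : {set 'I_n} := [set i : 'I_n | nth false w i].

Lemma size_word n (A : {set 'I_n}) : size (word A) = n.
Proof. by rewrite size_map size_enum_ord. Qed.

Lemma nth_word n (A : {set 'I_n}) (i : 'I_n) : nth false (word A) i = (i \in A).
Proof. by rewrite (nth_map i) ?nth_ord_enum // size_enum_ord. Qed.

Lemma count_word n (A : {set 'I_n}) : count id (word A) = #|A|.
Proof. by rewrite count_map -size_filter enumT cardE. Qed.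

Lemma set_of_wordK n w : size w = n -> word (set_of_word n w) = w.
Proof.
move=> sw; apply: (@eq_from_nth _ false); rewrite size_word // => i ltin.
by rewrite (nth_word _ (Ordinal ltin)) inE.
Qed.

(* The rank of the bottom of the chain labelled [c] is read off as [#|c|]. *)
Definition symmetric_chains n (cls : {set 'I_n} -> {set 'I_n}) : Prop :=
  [/\ forall A B, cls A = cls B -> #|A| <= #|B| -> A \subset B,
      forall A, #|cls A| <= #|A| /\ #|A| + #|cls A| <= n &
      forall A j, #|cls A| <= j -> j + #|cls A| <= n ->
        exists2 B, cls B = cls A & #|B| = j].

Lemma symmetric_chains_exist n : exists cls, @symmetric_chains n cls.
Proof.
pose cls (A : {set 'I_n}) := set_of_word n (bracket (word A)).
have clsE A : word (cls A) = bracket (word A).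
  by apply: set_of_wordK; rewrite size_bracket size_word.
have card_cls A : #|cls A| = count id (bracket (word A)) by rewrite -count_word clsE.
exists cls; split.
- move=> A B eqc; rewrite -!count_word => leAB; apply/subsetP=> i.
  by rewrite -!nth_word; apply: bracket_chain => //; rewrite -!clsE eqc.
- move=> A; rewrite card_cls -count_word.
  by have := count_bracket (word A); rewrite size_word.
- move=> A j; rewrite card_cls => lej jle.
  have [|w eqw cw] := bracket_full lej; first by rewrite size_word.
  have sw : size w = n by rewrite -size_bracket eqw size_bracket size_word.
  exists (set_of_word n w); last by rewrite -count_word set_of_wordK.
  by rewrite /cls set_of_wordK // eqw.
Qed.

Lemma symmetric_chains_perm n (cls : {set 'I_n} -> {set 'I_n}) (s : {perm 'I_n}) :
  symmetric_chains cls -> symmetric_chains (fun A => cls (s @: A)).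
Proof.
have card_s (A : {set 'I_n}) : #|s @: A| = #|A| by rewrite card_imset //; exact: perm_inj.
case=> chain range full; split=> [A B eqc leAB | A | A j lej jle].
- have sub : s @: A \subset s @: B by apply: chain; rewrite ?card_s.
  apply/subsetP=> i iA; rewrite -(mem_imset (mem B) _ (@perm_inj _ s)).
  by apply: (subsetP sub); apply: imset_f.
- by have := range (s @: A); rewrite card_s.
- have [B eqB cB] := full (s @: A) j lej jle.
  have sK : s @: ((s^-1)%g @: B) = B.
    by rewrite -imset_comp -[RHS]imset_id; apply: eq_imset => i /=; rewrite permKV.
  by exists ((s^-1)%g @: B); rewrite ?sK // -card_s sK.
Qed.

(** * Copies inside one chain of the decomposition *)

Definition monochromatic (T L : finType) (cls : T -> L) (K : {set T}) : bool :=
  [forall A in K, forall B in K, cls A == cls B].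

Lemma leq_bin_sub f k : 0 < k -> f - k.-1 <= 'C(f, k).
Proof.
case: k => // k _ /=; elim: f => // f IH; rewrite binS.
have [lt|le] := leqP f.+1 k; first lia.
have := bin_gt0 f k; lia.
Qed.

(** The sizes in a class fill an interval symmetric about [n / 2], so the class stays within the
    window of middle sizes or covers it. *)
Lemma class_middle n (cls : {set 'I_n} -> {set 'I_n}) m c :
  symmetric_chains cls ->
  [set A | cls A == c] \subset middle_floor n m \/
  m <= #|[set A in middle_floor n m | cls A == c]|.
Proof.
case=> chain range full.
case: (set_0Vmem [set A | cls A == c]) => [->|[A0]]; first by left; exact: sub0set.
rewrite inE => /eqP A0c.
set lo : int := ((n%:Z - m%:Z + 1) %/ 2)%Z%R.
(* Strict: the window may end at [n - lo - 1], and a class starting at [lo] can then stick out on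
   top. *)
have [lo_lt|lo_ge] := boolP (lo < #|c|%:Z)%R.
  left; apply/subsetP=> A; rewrite !inE => /eqP Ac.
  by have := range A; rewrite Ac; lia.
right.
have ex (j : 'I_m) : exists B, (cls B == c) && (#|B| == `|lo|%N + j).
  have := ltn_ord j => ltj.
  have [] := full A0 (`|lo|%N + j); rewrite ?A0c; [lia|lia|].
  by move=> B cB sB; exists B; rewrite cB sB !eqxx.
pose f j := xchoose (ex j).
have fP j : cls (f j) = c /\ #|f j| = `|lo|%N + j.
  by have /andP[/eqP ? /eqP ?] := xchooseP (ex j).
have f_inj : injective f.
  move=> i j eqf; have [_ ci] := fP i; have [_ cj] := fP j.
  by apply: val_inj => /=; rewrite eqf cj in ci; lia.
rewrite -[X in X <= _]card_ord -(card_imset _ f_inj) subset_leq_card //.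
apply/subsetP=> _ /imsetP[j _ ->]; have [fc cf] := fP j.
by rewrite !inE fc eqxx cf andbT; have := ltn_ord j; lia.
Qed.

(* Every chain of the decomposition containing [f] members of [F] contributes
   ['C(f, k) >= f - (k - 1)] copies, and it meets the [k - 1] middle layers in
   at least [minn f (k - 1)] sets. *)
Lemma monochromatic_copies n k (F : {set {set 'I_n}}) cls :
  0 < k -> symmetric_chains cls ->
  #|F| - Sigma n k.-1 <= #|[set K in chain_copies k F | monochromatic cls K]|.
Proof.
move=> k_gt0 scd; have [chain _ _] := scd.
(* Each copy is filed under the label of one of its members; only the empty set gets the default,
   and it is no copy as [0 < k]. *)
pose lab (K : {set {set 'I_n}}) := cls (odflt set0 [pick A in K]).
have sum_cls (S : {set {set 'I_n}}) : #|S| = \sum_c #|[set A in S | cls A == c]|.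
  rewrite -sum1_card (partition_big cls xpredT) //=.
  by apply: eq_bigr => c _; rewrite -sum1_card; apply: eq_bigl => A; rewrite !inE.
rewrite [#|F|]sum_cls /Sigma [#|middle_floor _ _|]sum_cls leq_subLR.
rewrite -[X in _ <= _ + X]sum1_card [X in _ <= _ + X](partition_big lab xpredT) //=.
rewrite -big_split /=; apply: leq_sum => c _; rewrite sum1_card.
set f := #|[set A in F | cls A == c]|; set b := #|[set A in middle_floor n k.-1 | cls A == c]|.
set N := (X in _ <= _ + X).
have le_bin : 'C(f, k) <= N.
  rewrite -cards_draws; apply/subset_leq_card/subsetP=> K; rewrite inE => /andP[/subsetP KF Kk].
  have Kc A : A \in K -> A \in F /\ cls A = c by move/KF; rewrite inE => /andP[-> /eqP].
  rewrite unfold_in /= !inE Kk /=; apply/andP; split; last first.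
    rewrite /lab; case: pickP => [A /Kc[_ ->] //|K0].
    by move: Kk; rewrite (eq_card0 K0) => /eqP k0; rewrite -k0 in k_gt0.
  apply/andP; split.
    apply/andP; split; first by apply/subsetP=> A /Kc[].
    apply/forall_inP=> A /Kc[_ cA]; apply/forall_inP=> B /Kc[_ cB].
    by have [/chain->|/ltnW/chain->] := leqP #|A| #|B|; rewrite ?orbT // cA cB.
  apply/forall_inP=> A /Kc[_ cA]; apply/forall_inP=> B /Kc[_ cB].
  by rewrite cA cB.
have := leq_bin_sub f k_gt0.
have [/subsetP sub|] := @class_middle n cls k.-1 c scd; last by rewrite -/b; lia.
have : f <= b.
  apply/subset_leq_card/subsetP=> A; rewrite !inE => /andP[_ cA].
  by have := sub A; rewrite !inE cA => /(_ isT) ->.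
lia.
Qed.

(** * Permutations with prescribed images along a chain *)

(** Transpositions exchanging a point of [A :\: B] with one of [B :\: A] turn [A] into [B] and move
    only points of [S]. *)
Lemma perm_on_imset (T : finType) (A B S : {set T}) :
  A \subset S -> B \subset S -> #|A| = #|B| ->
  exists2 s : {perm T}, perm_on S s & s @: A = B.
Proof.
move: {2}#|A :\: B|.+1 (ltnSn #|A :\: B|) => m; elim: m A => // m IH A ltm AS BS cAB.
have [D0|[a]] := set_0Vmem (A :\: B).
  exists 1%g; first exact: perm_on1.
  have /eqP -> : A == B by rewrite eqEcard cAB leqnn andbT -setD_eq0 D0.
  by rewrite -[RHS]imset_id; apply: eq_imset => x; rewrite perm1.
rewrite inE => /andP[aB aA].
have [D0|[b]] := set_0Vmem (B :\: A).
  have /eqP BA : B == A by rewrite eqEcard cAB leqnn andbT -setD_eq0 D0.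
  by rewrite BA aA in aB.
rewrite inE => /andP[bA bB].
have nab : a != b by apply: contraNneq aB => ->.
pose A' := b |: (A :\ a).
have tA : tperm a b @: A = A'.
  apply/setP=> x; rewrite -{1}(tpermK a b x) (mem_imset _ _ (@perm_inj _ _)) !inE.
  case: tpermP => [->|->|/eqP/negPf-> /eqP/negPf-> //].
  - by rewrite (negPf nab) (negPf bA) eqxx.
  - by rewrite aA eqxx.
have cA' : #|A'| = #|A| by rewrite -tA card_imset //; exact: perm_inj.
have [| | |s sS sA] := IH A' _ _ BS.
- rewrite -ltnS; apply: leq_trans ltm; rewrite ltnS; apply: proper_card; apply/properP; split.
    by apply/subsetP=> x; rewrite !inE; case: (x =P b) => [->|_]; rewrite ?bB //= => /and3P[-> _ ->].
  by exists a; rewrite !inE ?aB ?aA // eqxx (negPf nab) !andbF.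
- rewrite subUset sub1set (subsetP BS) //=.
  by apply: subset_trans AS; rewrite subD1set.
- by rewrite cA'.
exists (tperm a b * s)%g; last first.
  by rewrite -sA -tA -imset_comp; apply: eq_imset => x; rewrite /= permM.
apply: perm_onM => //; apply: subset_trans (tperm_on a b) _.
by rewrite subUset !sub1set (subsetP AS) // (subsetP BS).
Qed.

Lemma imset_permM (T : finType) (s t : {perm T}) (A : {set T}) :
  (s * t)%g @: A = t @: (s @: A).
Proof. by rewrite -imset_comp; apply: eq_imset => x; rewrite /= permM. Qed.

(* Precomposing with permutations of [A2] moves [A1] to each of the
   ['C(#|A2|, #|A1|)] subsets of [A2] of its size, without affecting [P]. *)
Lemma card_perm_prescribed (T : finType) (A1 A2 : {set T}) (h : {set T} -> {set T})
    (P : pred {perm T}) :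
  A1 \subset A2 ->
  (forall s t : {perm T}, perm_on A2 t -> P (t * s)%g = P s) ->
  #|[set s | P s && (s @: A1 == h (s @: A2))]| * 'C(#|A2|, #|A1|)
    <= #|[set s | P s]|.
Proof.
move=> sA12 Pinv; set G := [set s | _ && _].
pose G' (X : {set T}) := [set s | P s && (s @: X == h (s @: A2))].
have cG' (X : {set T}) : X \subset A2 -> #|X| = #|A1| -> #|G' X| = #|G|.
  move=> sX cX; have [t tA2 tA1] := perm_on_imset sX sA12 cX.
  have tS := im_perm_on tA2.
  rewrite -(card_imset (mem G) (@mulgI _ t)); apply: eq_card => s.
  rewrite -(mulKVg t s) (mem_imset (mem G) _ (@mulgI _ t)) !inE Pinv //.
  by rewrite !imset_permM tA1 tS.
rewrite -cards_draws mulnC.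
set D := [set X : {set T} | _].
have -> : #|D| * #|G| = \sum_(X in D) #|G' X|.
  rewrite -sum_nat_const; apply: eq_bigr => X; rewrite inE => /andP[sX /eqP cX].
  by rewrite cG'.
under eq_bigr => X _ do rewrite -sum1_card.
rewrite (exchange_big_dep (fun s => s \in [set s | P s])) /=; last first.
  by move=> X s _; rewrite /G' !inE => /andP[].
(* Each [s] is counted for at most one [X], since [s @: A2] prescribes [s @: X]. *)
rewrite -sum1_card; apply: leq_sum => s _.
rewrite sum1_card; apply/card_le1_eqP => X Y /andP[_ sX] /andP[_ sY].
move: sX sY; rewrite !inE => /andP[_ /eqP eX] /andP[_ /eqP eY].
by apply: (imset_inj (@perm_inj _ s)); rewrite eX eY.
Qed.


(** The smallest pair is split off first: permutations of [A 1] fix all larger [A i] setwise, so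
    they preserve the other conditions. *)
Lemma card_perm_chain (T : finType) k (A : nat -> {set T}) (h : nat -> {set T} -> {set T}) :
  (forall i, i < k -> A i \subset A i.+1) ->
  #|[set s : {perm T} | [forall i : 'I_k, s @: A i == h i (s @: A i.+1)]]|
    * \prod_(i < k) 'C(#|A i.+1|, #|A i|) <= #|T|`!.
Proof.
elim: k A h => [|k IH] A h sA.
  rewrite big_ord0 muln1 -cardsT -card_perm; apply/subset_leq_card/subsetP=> s _.
  by rewrite unfold_in; apply/subsetP=> x _; rewrite inE.
rewrite big_ord_recl mulnA.
have sub0 i : i <= k -> A 1 \subset A i.+1.
  elim: i => // i IHi lti; apply: subset_trans (IHi (ltnW lti)) _.
  exact: sA.
pose P (s : {perm T}) := [forall i : 'I_k, s @: A i.+1 == h i.+1 (s @: A i.+2)].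
have Pinv s t : perm_on (A 1) t -> P (t * s)%g = P s.
  move=> tA1; apply: eq_forallb => i.
  have tA j : j <= k -> t @: A j.+1 = A j.+1.
    by move=> lej; apply: im_perm_on; apply: subset_trans tA1 (sub0 j lej).
  by rewrite !imset_permM !tA // ltnW.
apply: leq_trans (IH (fun i => A i.+1) (fun i => h i.+1) _); last first.
  by move=> i lti; apply: sA.
apply: leq_mul; last by [].
apply: leq_trans (card_perm_prescribed (h 0) (sA 0 isT) Pinv).
rewrite leq_mul2r; apply/orP; right; apply/subset_leq_card/subsetP=> s.
rewrite !inE => /forallP sP; rewrite (sP ord0) andbT.
by apply/forallP=> i; have := sP (lift ord0 i).
Qed.

(** * Falling factorials against products of binomials *)

Lemma leq_bin_self n m : 0 < m < n -> n <= 'C(n, m).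
Proof.
elim: n m => // n IH [|m] // /andP[_ ltm]; rewrite binS.
have [<-|nem] := eqVneq m.+1 n; first by rewrite binn binSn.
have := IH m.+1; have := bin_gt0 n m; lia.
Qed.

(** In factorials this is [(a - j)! (b - a)! <= (b - j - 1)!], that is [b - j <= 'C(b - j, a - j)],
    true as [0 < a - j < b - j]. *)
Lemma ffact_step a b j : j < a < b -> b ^_ j.+1 <= 'C(b, a) * a ^_ j.
Proof.
move=> /andP[ltja ltab].
have e1 : 'C(b, a) * a ^_ j * ((a - j)`! * (b - a)`!) = b`!.
  by rewrite -(bin_fact (ltnW ltab)) -(ffact_fact (ltnW ltja)); ring.
have e2 : b ^_ j.+1 * (b - j.+1)`! = b`! by rewrite ffact_fact //; lia.
have e3 : (a - j)`! * (b - a)`! <= (b - j.+1)`!.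
  have le : a - j <= b - j by lia.
  have := bin_fact le; rewrite (_ : b - j - (a - j) = b - a); last lia.
  have : b - j <= 'C(b - j, a - j) by apply: leq_bin_self; lia.
  have -> : (b - j)`! = (b - j) * (b - j.+1)`!.
    by rewrite -[in LHS](@prednK (b - j)) ?factS ?prednK; [congr (_ * _`!); lia | lia | lia].
  move=> leC eqf; rewrite -(@leq_pmul2l (b - j)); last lia.
  by rewrite -eqf leq_mul2r leC orbT.
rewrite -(@leq_pmul2r ((a - j)`! * (b - a)`!)) ?muln_gt0 ?fact_gt0 // e1 -e2.
by rewrite leq_mul2l e3 orbT.
Qed.

Lemma leq_ffact2 m n k : m <= n -> m ^_ k <= n ^_ k.
Proof.
elim: k m n => // k IH m n lemn; rewrite !ffactnS leq_mul // IH //; lia.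
Qed.

(** Iterates [ffact_step]; a positive start gives [i < a i], which that step requires. *)
Lemma ffact_prod_bin k (a : nat -> nat) :
  0 < a 0 -> (forall i, i < k -> a i < a i.+1) ->
  a k ^_ k <= \prod_(i < k) 'C(a i.+1, a i).
Proof.
move=> a0; elim: k => [|k IH] inc; first by rewrite ffactn0 big_ord0.
have ltk i : i <= k -> i < a i.
  by elim: i => // i IHi lti; have := inc i (ltnW lti); have := IHi (ltnW lti); lia.
rewrite big_ord_recr /=; apply: (leq_trans (@ffact_step (a k) _ k _)).
  by rewrite ltk ?inc.
by rewrite mulnC leq_mul2r IH ?orbT // => i lti; apply: inc; apply: ltnW.
Qed.

(** * Permutations sending a chain into one class *)

(* Within a class a set is determined by its size, so [s @: A i] is a function
   of [s @: A i.+1]. *)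
Lemma card_perm_same_class n k (L : eqType) (cls : {set 'I_n} -> L) (A : nat -> {set 'I_n}) :
  (forall X Y, cls X = cls Y -> #|X| = #|Y| -> X = Y) ->
  (forall i, i < k -> A i \proper A i.+1) ->
  0 < #|A 0| -> n <= #|A 0| + #|A k| ->
  #|[set s : {perm 'I_n} | [forall i : 'I_k, cls (s @: A i) == cls (s @: A i.+1)]]|
    * ((n + k.+1) %/ 2) ^_ k <= n`!.
Proof.
move=> cls_inj sA A0 nA.
have ltA i : i < k -> #|A i| < #|A i.+1| by move/sA/proper_card.
have leA i : i <= k -> #|A 0| + i <= #|A i|.
  by elim: i => [|i IH] lti; rewrite ?addn0 //; have := ltA i lti; have := IH (ltnW lti); lia.
(* The default is never reached on the permutations counted, where [s @: A i] is itself a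
   candidate. *)
pose h i (B : {set 'I_n}) :=
  odflt set0 [pick X : {set 'I_n} | (cls X == cls B) && (#|X| == #|A i|)].
have sA' i : i < k -> A i \subset A i.+1 by move/sA/proper_sub.
rewrite -[X in _ <= X`!]card_ord; apply: leq_trans (card_perm_chain h sA').
apply: leq_mul; last first.
  apply: leq_trans (ffact_prod_bin A0 ltA); apply: leq_ffact2.
  (* [#|A 0| + k <= #|A k|] and [n <= #|A 0| + #|A k|] give [n + k <= 2 * #|A k|]; rounding up
     yields [(n + k.+1) %/ 2]. *)
  by have := leA k (leqnn k); lia.
apply/subset_leq_card/subsetP=> s; rewrite !inE => /forallP sP; apply/forallP=> i.
have cA (X : {set 'I_n}) : #|s @: X| = #|X| by rewrite card_imset //; exact: perm_inj.
rewrite /h; case: pickP => [X /andP[/eqP cX /eqP sX]|/(_ (s @: A i))].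
  by apply/eqP/cls_inj; rewrite ?cA // cX (eqP (sP i)).
by rewrite (eqP (sP i)) cA !eqxx.
Qed.

Lemma chain_enum n k (K : {set {set 'I_n}}) :
  is_chain K -> #|K| = k.+1 ->
  exists2 A : nat -> {set 'I_n},
    forall i, i <= k -> A i \in K & forall i, i < k -> A i \proper A i.+1.
Proof.
move=> chK cK; pose le := fun X Y : {set 'I_n} => X \subset Y.
pose s := sort le (enum K).
have mem_s X : (X \in s) = (X \in K) by rewrite mem_sort mem_enum.
have uniq_s : uniq s by rewrite sort_uniq enum_uniq.
have size_s : size s = k.+1 by rewrite size_sort -cardE.
have sorted_s : sorted le s.
  apply: (@sort_sorted_in _ (mem K)).
    by move=> X Y XK YK; exact: (forall_inP (forall_inP chK X XK) Y YK).
  by apply/allP=> X; rewrite mem_enum.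
exists (nth set0 s) => i lti; first by rewrite -mem_s mem_nth ?size_s.
rewrite properEneq nth_uniq ?size_s ?ltnS ?(ltnW lti) // neq_ltn ltnSn /=.
by apply: (sortedP set0 sorted_s); rewrite size_s ltnS.
Qed.

(* The chain [set0], [setT] is monochromatic for every permutation, hence the
   last hypothesis. *)
Lemma card_perm_monochromatic n k (K : {set {set 'I_n}}) cls :
  0 < n -> symmetric_chains cls -> is_chain K -> #|K| = k.+1 ->
  ~~ ((set0 \in K) && (setT \in K)) ->
  #|[set s : {perm 'I_n} | monochromatic (fun A : {set 'I_n} => cls (s @: A)) K]|
    * ((n + k.+1) %/ 2) ^_ k <= n`!.
Proof.
move=> n_gt0 [chain _ _] chK cK not_both.
have cls_inj X Y : cls X = cls Y -> #|X| = #|Y| -> X = Y.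
  move=> cXY sXY; apply/eqP; rewrite eqEsubset.
  by rewrite !chain // sXY.
have [A AK sA] := chain_enum chK cK.
have leA : #|A 0| <= #|A k|.
  suff leA i : i <= k -> #|A 0| <= #|A i| by exact: leA.
  by elim: i => // i IH lti; have := IH (ltnW lti); have := proper_card (sA i lti); lia.
have cT : #|[set: 'I_n]| = n by rewrite cardsT card_ord.
have mono_cls (s : {perm 'I_n}) i j :
    monochromatic (fun A : {set 'I_n} => cls (s @: A)) K -> i <= k -> j <= k ->
    cls (s @: A i) = cls (s @: A j).
  move=> mK lei lej; apply/eqP.
  exact: (forall_inP (forall_inP mK _ (AK i lei)) _ (AK j lej)).
have [high|low] := leqP n (#|A 0| + #|A k|).
  (* A bottom of size 0 would force the top to be [setT]. *)
  have A0_gt0 : 0 < #|A 0|.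
    rewrite lt0n; apply: contraNneq not_both => A0; apply/andP; split.
      by move/eqP: A0; rewrite cards_eq0 => /eqP <-; exact: AK.
    suff <- : A k = setT by exact: AK.
    by apply/eqP; rewrite eqEcard subsetT cT; lia.
  apply: leq_trans (card_perm_same_class cls_inj sA A0_gt0 high).
  rewrite leq_mul2r; apply/orP; right; apply/subset_leq_card/subsetP=> s.
  by rewrite !inE => mK; apply/forallP=> i; rewrite (@mono_cls s i i.+1) // ltnW.
(* Below the middle, the chain of complements is used in reverse order, with [cls (~: X)] as label;
   permutations commute with complementation, so none is lost from the count. *)
pose A' i := ~: A (k - i).
have cA' i : #|A i| + #|~: A i| = n by rewrite cardsC card_ord.
have cls_inj' X Y : cls (~: X) = cls (~: Y) -> #|X| = #|Y| -> X = Y.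
  move=> cXY sXY; apply: (can_inj (@setCK _)); apply: cls_inj => //.
  by have := cardsC X; have := cardsC Y; lia.
have sA' i : i < k -> A' i \proper A' i.+1.
  move=> lti; rewrite /A' properC; have -> : k - i = (k - i.+1).+1 by lia.
  by apply: sA; lia.
have [A'0 A'k] : #|A' 0| + #|A k| = n /\ #|A' k| + #|A 0| = n.
  by rewrite /A' subn0 subnn addnC cA' addnC cA'.
have A'0_gt0 : 0 < #|A' 0| by lia.
have high : n <= #|A' 0| + #|A' k| by lia.
apply: leq_trans (card_perm_same_class cls_inj' sA' A'0_gt0 high).
rewrite leq_mul2r; apply/orP; right; apply/subset_leq_card/subsetP=> s.
rewrite !inE => mK; apply/forallP=> i.
have compl X : ~: (s @: (~: X)) = s @: X.
  apply/setP=> x; rewrite -(permKV s x) inE !(mem_imset _ _ (@perm_inj _ s)).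
  by rewrite inE negbK.
by rewrite /A' !compl (@mono_cls s _ (k - i.+1)) ?leq_subr.
Qed.

(** * Averaging over permutations *)

(* Double counting of the pairs [(s, K)] such that [s] maps [K] into one chain
   of a fixed symmetric chain decomposition. *)
Lemma chain_copies_avoiding n k (F : {set {set 'I_n}}) :
  0 < n -> ~~ ((set0 \in F) && (setT \in F)) ->
  (#|F| - Sigma n k) * ((n + k.+1) %/ 2) ^_ k <= #|chain_copies k.+1 F|.
Proof.
move=> n_gt0 not_both; have [cls scd] := symmetric_chains_exist n.
pose mono (s : {perm 'I_n}) := monochromatic (fun A : {set 'I_n} => cls (s @: A)).
set P := _ ^_ _.
have count_s (s : {perm 'I_n}) :
    #|F| - Sigma n k <= \sum_(K in chain_copies k.+1 F) mono s K.
  have := monochromatic_copies F (ltn0Sn k) (symmetric_chains_perm s scd).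
  move=> /leq_trans; apply; rewrite -sum1_card -big_mkcondr /=.
  by apply: eq_leq; apply: eq_bigl => K; rewrite inE.
have count_K K : K \in chain_copies k.+1 F -> (\sum_s mono s K) * P <= n`!.
  rewrite inE => /and3P[/subsetP KF /eqP cK chK].
  have not_bothK : ~~ ((set0 \in K) && (setT \in K)).
    by apply: contra not_both => /andP[/KF-> /KF->].
  have := card_perm_monochromatic n_gt0 scd chK cK not_bothK.
  apply: leq_trans; rewrite leq_mul2r; apply/orP; right.
  rewrite -sum1_card -big_mkcond /=.
  by apply: eq_leq; apply: eq_bigl => s; rewrite inE.
rewrite -(leq_pmul2l (fact_gt0 n)) mulnA.
have card_Sn : #|{perm 'I_n}| = n`!.
  rewrite -[in RHS](card_ord n) -[in RHS]cardsT -card_perm; apply: eq_card => s.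
  by rewrite inE; apply/esym/subsetP=> x _; rewrite inE.
apply: (@leq_trans (\sum_(s : {perm 'I_n}) \sum_(K in chain_copies k.+1 F) mono s K * P)).
  rewrite -card_Sn -mulnA -sum_nat_const; apply: leq_sum => s _.
  by rewrite -big_distrl /= leq_mul2r count_s orbT.
rewrite exchange_big /= mulnC -sum_nat_const; apply: leq_sum => K KF.
by rewrite -big_distrl /= count_K.
Qed.

(** * Families containing both the empty and the full set *)

Lemma card_layer n j : #|[set A : {set 'I_n} | #|A| == j]| = 'C(n, j).
Proof. by rewrite card_draws card_ord. Qed.

Lemma Sigma_layer n m j :
  (middle_floor n m :&: [set A : {set 'I_n} | #|A| == j] = set0) ->
  middle_floor n m :|: [set A : {set 'I_n} | #|A| == j] \subset middle_floor n m.+1 ->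
  Sigma n m + 'C(n, j) <= Sigma n m.+1.
Proof.
move=> disj /subset_leq_card; rewrite cardsU disj cards0 subn0.
by rewrite card_layer.
Qed.

(** The layer gained is the next one below if [n + m] is odd, the next one above otherwise. The
    bounds are fitted to the factor between the falling factorials for successive [k]. *)
Lemma Sigma_succ n m : m < n ->
  Sigma n m + (if odd (n + m) then (n - m).+1 %/ 2 else n) <= Sigma n m.+1.
Proof.
move=> ltmn; case: ifP => par.
  apply: (@leq_trans (Sigma n m + 'C(n, (n - m.+1) %/ 2))).
    (* For [m.+1 = n] the layer gained consists of [set0] alone, and the bound is 1. *)
    rewrite leq_add2l; have [e0|ne0] := eqVneq ((n - m.+1) %/ 2) 0; last first.
      by apply: leq_trans (@leq_bin_self n ((n - m.+1) %/ 2) _); lia.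
    by rewrite e0 bin0; lia.
  apply: Sigma_layer; first by apply/setP=> A; rewrite !inE; lia.
  by apply/subsetP=> A; rewrite !inE; lia.
apply: (@leq_trans (Sigma n m + 'C(n, (n + m) %/ 2))).
  by rewrite leq_add2l; apply: leq_bin_self; lia.
apply: Sigma_layer; first by apply/setP=> A; rewrite !inE; lia.
by apply/subsetP=> A; rewrite !inE; lia.
Qed.

Lemma Sigma_full n m : n < m -> Sigma n m = #|[set: {set 'I_n}]|.
Proof.
move=> ltnm; apply: eq_card => A; rewrite !inE.
by have := subset_leq_card (subsetT A); rewrite cardsT card_ord; lia.
Qed.

(** Adjoining [set0] to the [k]-chains that avoid it gives [k.+1]-chains, distinct from those that
    avoid [set0]. *)
Lemma chain_copies_set0 n k (F : {set {set 'I_n}}) :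
  set0 \in F ->
  #|chain_copies k.+1 (F :\ set0)| + #|chain_copies k (F :\ set0)|
    <= #|chain_copies k.+1 F|.
Proof.
move=> F0.
pose add0 (K : {set {set 'I_n}}) := set0 |: K.
have notin0 m K : K \in chain_copies m (F :\ set0) -> set0 \notin K.
  rewrite inE => /and3P[/subsetP KF _ _]; apply/negP=> /KF.
  by rewrite !inE eqxx.
have inj0 : {in chain_copies k (F :\ set0) &, injective add0}.
  move=> K1 K2 /notin0 K1P /notin0 K2P eq12.
  by rewrite -(setU1K K1P) -(setU1K K2P) -/(add0 _) eq12.
rewrite -(card_in_imset inj0) -cardsUI [X in _ + X](_ : _ = 0) ?addn0; last first.
  apply/eqP; rewrite cards_eq0; apply/eqP/setP=> K; rewrite in_setI in_set0.
  apply/negP=> /andP[/notin0 K0 /imsetP[K' _ eK]]; rewrite eK in K0.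
  by rewrite setU11 in K0.
apply/subset_leq_card/subsetP=> K; rewrite in_setU => /orP[|/imsetP[K' K'P ->]].
  rewrite !inE => /and3P[KF -> ->]; rewrite !andbT.
  exact: subset_trans KF (subD1set _ _).
have K'0 := notin0 _ _ K'P; move: K'P; rewrite !inE => /and3P[KF cK chK].
rewrite cardsU1 K'0 (eqP cK) eqxx subUset sub1set F0 (subset_trans KF (subD1set _ _)) /=.
apply/forall_inP=> A; rewrite in_setU1 => /predU1P[->|AK]; apply/forall_inP=> B.
  by rewrite sub0set.
rewrite in_setU1 => /predU1P[->|BK]; first by rewrite sub0set orbT.
exact: (forall_inP (forall_inP chK _ AK) _ BK).
Qed.

Lemma chain_copies0 n (F : {set {set 'I_n}}) : 0 < #|chain_copies 0 F|.
Proof.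
apply/card_gt0P; exists set0; rewrite inE sub0set cards0 /=.
by apply/forall_inP=> A; rewrite inE.
Qed.

Lemma chain_copies_lb n k (F : {set {set 'I_n}}) :
  0 < n ->
  (#|F| - Sigma n k) * ((n + k.+1) %/ 2) ^_ k <= #|chain_copies k.+1 F|.
Proof.
move=> n_gt0; have [/andP[F0 FT]|] := boolP ((set0 \in F) && (setT \in F)); last first.
  exact: chain_copies_avoiding.
have [|ltF] := leqP #|F| (Sigma n k); first by rewrite -subn_eq0 => /eqP->; rewrite mul0n.
have cF := cardsD1 set0 F; rewrite F0 add1n in cF.
have avoid : ~~ ((set0 \in F :\ set0) && (setT \in F :\ set0)) by rewrite !inE eqxx.
(* Dropping [set0] lowers the surplus over [Sigma n k] by one, so it suffices that [set0] lies in as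
   many copies as the falling factorial. *)
apply: leq_trans (chain_copies_set0 k F0).
rewrite cF ltnS in ltF; rewrite cF subSn // -addn1 mulnDl mul1n leq_add ?chain_copies_avoiding //.
have lekn : k <= n.
  rewrite leqNgt; apply/negP=> /Sigma_full eqS; move: ltF.
  by rewrite eqS leqNgt -cF subset_leq_card // subsetT.
case: k ltF lekn => [|k] ltF lekn; first by rewrite ffactn0 chain_copies0.
apply: leq_trans (chain_copies_avoiding k n_gt0 avoid).
(* By [ltF] the surplus of [F :\ set0] over [Sigma n k] is at least the layer gained. This supplies
   the missing factor of the falling factorial: the last one for odd [n + k], the first one for even
   [n + k]. *)
have := Sigma_succ lekn; case: ifP => par step.
  have -> : (n + k.+2) %/ 2 = (n + k.+1) %/ 2 by lia.
  rewrite ffactnSr [leqLHS]mulnC leq_mul //.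
  by apply: leq_trans (leq_sub2r _ ltF); lia.
have -> : (n + k.+2) %/ 2 = ((n + k.+1) %/ 2).+1 by lia.
rewrite ffactSS leq_mul //.
by apply: leq_trans (leq_sub2r _ ltF); lia.
Qed.

(** * Passage to integers *)

Import Order.TTheory GRing.Theory Num.Theory.
Local Open Scope ring_scope.

(** For [k > m] negative factors may occur, but the factor at [i = m + 1] is 0 and both sides
    vanish. *)
Lemma prod_int_ffact m k : \prod_(1 <= i < k.+1) (m%:Z - i%:Z + 1) = (m ^_ k)%:Z.
Proof.
elim: k => [|k IH]; first by rewrite big_geq // ffactn0.
rewrite big_nat_recr //= IH ffactnSr PoszM; have [lekm|ltmk] := leqP k m.
  by congr (_ * _); lia.
by rewrite ffact_small // !mul0r.
Qed.

Theorem theorem1p2 (n k : nat) (hn : (0 < n)%N) (hk : (0 < k)%N) (x : int)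
    (F : {set {set 'I_n}}) (hF : #|F|%:Z = x + (Sigma n k.-1)%:Z) :
  x * \prod_(1 <= i < k) (((n + k) %/ 2)%N%:Z - i%:Z + 1)
    <= #|chain_copies k F|%:Z.
Proof.
case: k hk hF => // k _ hF; rewrite prod_int_ffact.
have := chain_copies_lb k F hn; rewrite -lez_nat PoszM; apply: le_trans.
(* The truncated difference is at least [x] even when [x] is negative. *)
by apply: ler_wpM2r; rewrite //= in hF *; lia.
Qed.
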